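(* Over binary schemas, the query languages $(\mathcal{ALC},\mathrm{UCQ})$ and MDDlog have the same expressive power. That is, for every ontology-mediated query $(\mathbf{S},\mathcal{O},q)$ with $\mathcal{O}$ an $\mathcal{ALC}$-ontology and $q$ a union of conjunctive queries there is an MDDlog program defining an equivalent query over $\mathbf{S}$, and conversely every query defined by an MDDlog program is equivalent to such an ontology-mediated query.
   Context: **Queries.** A schema $\mathbf{S}$ is a finite set of relation symbols with arities; it is binary if all its symbols have arity one (concept names) or two (role names). An instance $\mathfrak{D}$ over $\mathbf{S}$ is a finite set of facts $R(a_1,\dots,a_n)$, $R\in\mathbf{S}$, with $a_i$ from a fixed countably infinite set of constants; $\mathrm{adom}(\mathfrak{D})$ is the set of constants occurring in $\mathfrak{D}$. An $n$-ary query over $\mathbf{S}$ maps each $\mathbf{S}$-instance $\mathfrak{D}$ to a set $q(\mathfrak{D})\subseteq \mathrm{adom}(\mathfrak{D})^n$. Two queries over $\mathbf{S}$ are equivalent if they agree on all $\mathbf{S}$-instances. A query language is a set of queries. $\mathcal{Q}_2$ is at least as expressive as $\mathcal{Q}_1$ if every query of $\mathcal{Q}_1$ over some schema $\mathbf{S}$ is equivalent to a query of $\mathcal{Q}_2$ over $\mathbf{S}$; they have the same expressive power if this holds in both directions. UCQ is the class of unions of conjunctive queries (without constants; equality allowed). **Ontology-mediated queries.** An ontology language $\mathcal{L}$ is a set of first-order (FO) sentences; an $\mathcal{L}$-ontology $\mathcal{O}$ is a finite set of sentences of $\mathcal{L}$, and $\mathrm{sig}(\mathcal{O})$ is the set of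 its relation symbols. An ontology-mediated query is a triple $(\mathbf{S},\mathcal{O},q)$ with $\mathbf{S}$ a schema (the data schema), $\mathcal{O}$ an ontology and $q$ a query over $\mathbf{S}\cup\mathrm{sig}(\mathcal{O})$. A finite relational structure over a schema is a pair $(\mathrm{dom},\mathfrak{D})$ with $\mathrm{dom}$ a finite non-empty set and $\mathfrak{D}$ an instance over the schema with $\mathrm{adom}(\mathfrak{D})\subseteq\mathrm{dom}$. The triple defines the query over $\mathbf{S}$ that maps $\mathfrak{D}$ to the set of certain answers: all $\mathbf{a}\in\mathrm{adom}(\mathfrak{D})^n$ such that $\mathbf{a}\in q(\mathfrak{D}')$ for every finite relational structure $(\mathrm{dom},\mathfrak{D}')$ over $\mathbf{S}\cup\mathrm{sig}(\mathcal{O})$ that satisfies $\mathcal{O}$ and has $\mathfrak{D}\subseteq\mathfrak{D}'$. $(\mathcal{L},\mathcal{Q})$ denotes the query language of all queries defined by ontology-mediated queries $(\mathbf{S},\mathcal{O},q)$ with $\mathcal{O}$ an $\mathcal{L}$-ontology and $q\in\mathcal{Q}$. **$\mathcal{ALC}$.** $\mathcal{ALC}$-concepts: $C,D::=A\mid\top\mid\bot\mid\neg C\mid C\sqcap D\mid C\sqcup D\mid\exists R.C\mid\forall R.C$ with $A$ a concept name, $R$ a role name. They translate to FO formulas with one free variable: $A^*(x)=A(x)$; $\top,\bot$ and Booleans as expected; $(\exists R.C)^*(x)=\exists y(R(x,y)\wedge C^*(y))$; $(\forall R.C)^*(x)=\forall y(R(x,y)\to C^*(y))$. An $\mathcal{ALC}$-ontology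 is a finite set of concept inclusions $C\sqsubseteq D$, read as $\forall x(C^*(x)\to D^*(x))$. **MDDlog.** A disjunctive datalog rule has the form $S_1(\mathbf{x}_1)\vee\cdots\vee S_m(\mathbf{x}_m)\leftarrow R_1(\mathbf{y}_1)\wedge\cdots\wedge R_n(\mathbf{y}_n)$, $m\ge 0$, $n>0$, where every head variable occurs in the body (empty head: $\bot$). A disjunctive datalog (DDlog) program $\Pi$ is a finite set of such rules with a selected predicate $\mathsf{goal}$ that does not occur in rule bodies and occurs in heads only in rules $\mathsf{goal}(\mathbf{x})\leftarrow R_1(\mathbf{x}_1)\wedge\cdots\wedge R_n(\mathbf{x}_n)$. Its arity is that of $\mathsf{goal}$. Relation symbols occurring in some rule head are IDB predicates, the others EDB predicates. $\Pi$ defines the query $q_\Pi$ over the schema of its EDB predicates: $q_\Pi(\mathfrak{D})$ is the set of $\mathbf{a}\in\mathrm{adom}(\mathfrak{D})^n$ with $\mathsf{goal}(\mathbf{a})\in\mathfrak{D}'$ for all instances $\mathfrak{D}'\supseteq\mathfrak{D}$ over the IDB and EDB predicates satisfying all rules of $\Pi$. $\Pi$ is an MDDlog program if all IDB predicates except possibly $\mathsf{goal}$ are unary. MDDlog denotes the language of all queries defined by MDDlog programs.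
   Formalization: In the direction from (ALC,UCQ) to MDDlog, equivalence for Boolean queries is required only on non-empty instances, since no MDDlog program has an answer on the empty instance while the ontology ⊤⊑A with query ∃x A(x) is true there. *)

(* Defs.v *)
From Stdlib Require List.
From mathcomp Require Import all_boot finmap.

Set Implicit Arguments.
Unset Strict Implicit.
Unset Printing Implicit Defensive.

Local Open Scope fset_scope.

(* A relation symbol is a name together with its arity, so there are infinitely
   many symbols of each arity and a schema carries its arities with it. *)
Definition symb := (nat * nat)%type.
Definition arity (R : symb) : nat := R.2.
Definition schema := {fset symb}.
Definition binary (S : schema) : Prop :=
  forall R, R \in S -> arity R = 1 \/ arity R = 2.

Definition atom (V : Type) := {R : symb & (arity R).-tuple V}.
Definition Atom {V : Type} (R : symb) (t : (arity R).-tuple V) : atom V :=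
  Tagged (fun R => (arity R).-tuple V) t.
Definition asymb {V : Type} (F : atom V) : symb := tag F.
Definition aargs {V : Type} (F : atom V) : seq V := tagged F.
Definition atom_map {V W : Type} (h : V -> W) (F : atom V) : atom W :=
  Atom (map_tuple h (tagged F)).

Definition const := nat.
Definition fact := atom const.
Definition instance := {fset fact}.
Definition over_schema (S : schema) (D : instance) : Prop :=
  forall F, F \in D -> asymb F \in S.
Definition adom (D : instance) : {fset const} :=
  [fset c in flatten [seq aargs F | F <- enum_fset D]].

(* A query is only ever looked at on the instances over the schema with which
   it is paired in a query language. *)
Definition query (n : nat) := instance -> n.-tuple const -> Prop.
Definition query_language := forall (S : schema) (n : nat), query n -> Prop.

Definition equivalent (S : schema) (n : nat) (q1 q2 : query n) : Prop :=
  forall D, over_schema S D -> forall a, q1 D a <-> q2 D a.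

(* The empty instance is exempted for Boolean queries (and only for them):
   rule bodies are non-empty, so no disjunctive datalog program has an answer
   on the empty instance, whereas structures have a non-empty domain, so the
   ontology {top [= A} with the query "exists x, A(x)" is true on it. *)
Definition equivalent_but_empty (S : schema) (n : nat) (q1 q2 : query n) : Prop :=
  forall D, over_schema S D -> (n = 0 -> D != fset0) -> forall a, q1 D a <-> q2 D a.

(* Over binary schemas, every query of Q1 is expressed in Q2, up to E. *)
Definition at_least_as_expressive
    (E : forall (S : schema) (n : nat), query n -> query n -> Prop)
    (Q2 Q1 : query_language) : Prop :=
  forall (S : schema), binary S -> forall (n : nat) (q1 : query n), Q1 S n q1 ->
    exists2 q2 : query n, Q2 S n q2 & E S n q1 q2.

(* Unions of conjunctive queries. Of the variables 'I_n + 'I_k of a conjunctive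
   query, the left ones are the answer variables and the right ones are
   existentially quantified. *)
Inductive literal (V : Type) :=
  | LRel of atom V
  | LEq of V & V.

Record cq (n : nat) := CQ {
  cq_nex : nat;
  cq_body : seq (literal ('I_n + 'I_cq_nex)) }.

Definition ucq (n : nat) := seq (cq n).

Definition literal_symbs V (l : literal V) : seq symb :=
  if l is LRel F then [:: asymb F] else [::].
Definition cq_symbs n (p : cq n) : seq symb :=
  flatten (map (@literal_symbs _) (cq_body p)).
Definition ucq_symbs n (u : ucq n) : seq symb :=
  flatten (map (@cq_symbs n) u).

Definition literal_holds V (D : instance) (h : V -> const) (l : literal V) : bool :=
  match l with
  | LRel F => atom_map h F \in D
  | LEq x y => h x == h y
  end.

Definition cq_assign n k (a : n.-tuple const) (b : k.-tuple const)
    (x : 'I_n + 'I_k) : const :=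
  match x with inl i => tnth a i | inr j => tnth b j end.

Definition cq_eval n (p : cq n) : query n := fun D a =>
  {subset a <= adom D} /\
  exists2 b : (cq_nex p).-tuple const, {subset b <= adom D}
    & all (literal_holds D (cq_assign a b)) (cq_body p).

Definition ucq_eval n (u : ucq n) : query n := fun D a =>
  List.Exists (fun p => cq_eval p D a) u.

Variant UCQ : query_language :=
  | UCQ_query S n (u : ucq n) of {subset ucq_symbs u <= S} : UCQ S (ucq_eval u).

Definition var := nat.

Inductive fo :=
  | FTrue
  | FFalse
  | FAtom of atom var
  | FEq of var & var
  | FNot of fo
  | FAnd of fo & fo
  | FOr of fo & fo
  | FImp of fo & fo
  | FEx of var & fo
  | FAll of var & fo.

Fixpoint fo_symbs (phi : fo) : seq symb :=
  match phi with
  | FTrue | FFalse | FEq _ _ => [::]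
  | FAtom F => [:: asymb F]
  | FNot f | FEx _ f | FAll _ f => fo_symbs f
  | FAnd f g | FOr f g | FImp f g => fo_symbs f ++ fo_symbs g
  end.

Record structure := Structure {
  sdom : {fset const};
  sinst : instance;
  sdom_neq0 : sdom != fset0;
  sdom_adom : adom sinst `<=` sdom }.

Fixpoint sat (A : structure) (h : var -> sdom A) (phi : fo) : Prop :=
  match phi with
  | FTrue => True
  | FFalse => False
  | FAtom F => atom_map (fun x => val (h x)) F \in sinst A
  | FEq x y => h x = h y
  | FNot f => ~ sat h f
  | FAnd f g => sat h f /\ sat h g
  | FOr f g => sat h f \/ sat h g
  | FImp f g => sat h f -> sat h g
  | FEx x f => exists d : sdom A, sat [eta h with x |-> d] f
  | FAll x f => forall d : sdom A, sat [eta h with x |-> d] f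
  end.

Definition ontology_language := fo -> Prop.
Definition ontology := seq fo.
Definition sig_of (O : ontology) : schema := [fset R in flatten (map fo_symbs O)].

(* The assignment h is irrelevant for sentences. *)
Definition models (A : structure) (O : ontology) : Prop :=
  List.Forall (fun phi => forall h : var -> sdom A, sat h phi) O.

Definition certain_answers (S : schema) (O : ontology) n (q : query n) : query n :=
  fun D a => {subset a <= adom D} /\
    forall A : structure, over_schema (S `|` sig_of O) (sinst A) -> models A O ->
      D `<=` sinst A -> q (sinst A) a.

Variant OMQ (L : ontology_language) (Q : query_language) : query_language :=
  | OMQ_query S (O : ontology) n (q : query n)
      of List.Forall L O & Q (S `|` sig_of O) n q : OMQ L Q S (certain_answers S O q).

Inductive concept :=
  | CName of nat
  | CTop
  | CBot
  | CNot of concept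
  | CAnd of concept & concept
  | COr of concept & concept
  | CEx of nat & concept
  | CAll of nat & concept.

(* The only free variable of [concept_fo C x] is x; the quantified variable
   x.+1 is distinct from it, so nothing is captured. *)
Fixpoint concept_fo (C : concept) (x : var) : fo :=
  match C with
  | CName A => FAtom (@Atom _ (A, 1) [tuple x])
  | CTop => FTrue
  | CBot => FFalse
  | CNot C => FNot (concept_fo C x)
  | CAnd C D => FAnd (concept_fo C x) (concept_fo D x)
  | COr C D => FOr (concept_fo C x) (concept_fo D x)
  | CEx R C =>
      FEx x.+1 (FAnd (FAtom (@Atom _ (R, 2) [tuple x; x.+1])) (concept_fo C x.+1))
  | CAll R C =>
      FAll x.+1 (FImp (FAtom (@Atom _ (R, 2) [tuple x; x.+1])) (concept_fo C x.+1))
  end.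

Variant ALC : ontology_language :=
  | ALC_inclusion C D : ALC (FAll 0 (FImp (concept_fo C 0) (concept_fo D 0))).

(* A pair (head, body); the head is a disjunction, the body a conjunction. *)
Definition rule := (seq (atom var) * seq (atom var))%type.
Definition rule_head (r : rule) := r.1.
Definition rule_body (r : rule) := r.2.

Definition vars_of (s : seq (atom var)) : seq var := flatten (map aargs s).
Definition symbs_of (s : seq (atom var)) : seq symb := map asymb s.

Record program (n : nat) := Program {
  goal_name : nat;
  rules : seq rule }.
Definition goal n (P : program n) : symb := (goal_name P, n).

Definition ddlog n (P : program n) : Prop :=
  forall r, r \in rules P ->
    [/\ rule_body r != [::],
        {subset vars_of (rule_head r) <= vars_of (rule_body r)},
        goal P \notin symbs_of (rule_body r)
      & goal P \in symbs_of (rule_head r) -> size (rule_head r) = 1].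

Definition idb n (P : program n) : schema :=
  [fset R in flatten [seq symbs_of (rule_head r) | r <- rules P]].
Definition edb n (P : program n) : schema :=
  [fset R in flatten [seq symbs_of (rule_body r) | r <- rules P]] `\` idb P.

Definition mddlog n (P : program n) : Prop :=
  ddlog P /\ forall R, R \in idb P -> R != goal P -> arity R = 1.

Definition rule_holds (D : instance) (r : rule) : Prop :=
  forall h : var -> const,
    all (fun F => atom_map h F \in D) (rule_body r) ->
    has (fun F => atom_map h F \in D) (rule_head r).

Definition program_eval n (P : program n) : query n := fun D a =>
  {subset a <= adom D} /\
  forall D' : instance, D `<=` D' -> over_schema (idb P `|` edb P) D' ->
    (forall r, r \in rules P -> rule_holds D' r) ->
    @Atom _ (goal P) a \in D'.

Variant MDDlog : query_language :=
  | MDDlog_query n (P : program n) of mddlog P : MDDlog (edb P) (program_eval P).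

(* Main.v *)
Require Import Defs.
From mathcomp Require Import all_boot finmap boolp.

(** From MDDlog to ontology-mediated queries: for every unary IDB predicate A the
    ontology lets each element choose between A and a fresh name "bar A", and
    the query asks for a violated rule, reading "bar A" as "not A"; a goal head
    counts as violated when its arguments are the answer tuple.

    From ontology-mediated queries to MDDlog: the program guesses for every
    constant a profile, i.e. which subconcepts of the ontology and which
    subqueries rooted at the constant hold there in some model, and it contains
    every sound goal rule of bounded size over the data and profile symbols. If
    the guess derives no goal(a), glue to each constant d of the data a copy of
    a finite model realizing the profile of d, sharing only d. Concepts keep
    their values under gluing. A match of the query splits into data atoms and,
    for each constant, a subquery rooted at that constant, so its data part
    together with the profiles of the constants involved is the body of one of
    the sound rules deriving goal(a). *)

Set Implicit Arguments.
Unset Strict Implicit.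
Unset Printing Implicit Defensive.

Local Open Scope fset_scope.

(** * Atoms, active domains and fresh names *)

(** Comparing arguments as plain sequences avoids transporting tuples along an equality of
    arities. *)
Lemma atom_eq (V : Type) (F G : atom V) : asymb F = asymb G -> aargs F = aargs G -> F = G.
Proof.
case: F G => [R s] [R' t]; rewrite /asymb /aargs /= => E.
by case: _ / E t => t /val_inj ->.
Qed.

Lemma atom_map_comp (V W U : Type) (g : W -> U) (f : V -> W) (F : atom V) :
  atom_map g (atom_map f F) = atom_map (g \o f) F.
Proof. by apply: atom_eq => //; rewrite /aargs /= -map_comp. Qed.

Lemma size_aargs (V : Type) (F : atom V) : size (aargs F) = arity (asymb F).
Proof. exact: size_tuple. Qed.

Lemma eq_in_atom_map (V : eqType) (W : Type) (f g : V -> W) (F : atom V) :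
  {in aargs F, f =1 g} -> atom_map f F = atom_map g F.
Proof. by move=> fg; apply: atom_eq => //; apply/eq_in_map. Qed.

Lemma atom_map_id_in (V : eqType) (f : V -> V) (F : atom V) :
  {in aargs F, f =1 id} -> atom_map f F = F.
Proof. by move=> fid; apply: atom_eq => //; rewrite -[RHS]map_id; apply/eq_in_map. Qed.

Lemma vars_ofP (s : seq (atom var)) x :
  reflect (exists2 F, F \in s & x \in aargs F) (x \in vars_of s).
Proof. exact: flatten_mapP. Qed.

Lemma adomP (D : instance) c :
  reflect (exists2 F, F \in D & c \in aargs F) (c \in adom D).
Proof. by rewrite inE; apply: flatten_mapP. Qed.

Lemma mem_adom (D : instance) F c : F \in D -> c \in aargs F -> c \in adom D.
Proof. by move=> FD cF; apply/adomP; exists F. Qed.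

Lemma adomS (D D' : instance) : D `<=` D' -> {subset adom D <= adom D'}.
Proof. by move=> /fsubsetP sDD' c /adomP[F /sDD']; apply: mem_adom. Qed.

Definition fresh_name (s : seq symb) := (\max_(R <- s) R.1).+1.

Lemma ltn_fresh_name (s : seq symb) R : R \in s -> R.1 < fresh_name s.
Proof. by move=> Rs; rewrite ltnS (leq_bigmax_seq R). Qed.

Lemma eq_literal_holds (V : Type) D (f g : V -> const) (l : literal V) :
  f =1 g -> literal_holds D f l = literal_holds D g l.
Proof.
move=> fg; case: l => [F|x y] /=; last by rewrite !fg.
by congr (_ \in D); apply: atom_eq => //; apply: eq_map.
Qed.

Definition tuples_over n (X : {fset const}) : {fset n.-tuple const} :=
  [fset map_tuple (fun c : X => val c) t | t : n.-tuple X].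

Lemma tuples_overP n X (a : n.-tuple const) :
  reflect {subset a <= X} (a \in tuples_over n X).
Proof.
rewrite /tuples_over; apply: (iffP (imfsetP _ _ _ _)) => [[t _ ->] c /mapP[d _ ->]|sub].
  exact: valP.
have aX i : tnth a i \in X by apply/sub/mem_tnth.
exists [tuple [` aX i] | i < n] => //.
by apply: eq_from_tnth => i; rewrite tnth_map tnth_mktuple.
Qed.

(** * Concept semantics on instances and models of concept inclusions *)

(* Successors need not be restricted to the domain of a structure, which contains
   the active domain. *)
Fixpoint csem (I : instance) (C : concept) (c : const) : Prop :=
  match C with
  | CName A => @Atom const (A, 1) [tuple c] \in I
  | CTop => True
  | CBot => False
  | CNot C => ~ csem I C c
  | CAnd C D => csem I C c /\ csem I D c
  | COr C D => csem I C c \/ csem I D c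
  | CEx R C => exists2 d, @Atom const (R, 2) [tuple c; d] \in I & csem I C d
  | CAll R C => forall d, @Atom const (R, 2) [tuple c; d] \in I -> csem I C d
  end.

Lemma arg_sdom (A : structure) F c : F \in sinst A -> c \in aargs F -> c \in sdom A.
Proof. by move=> FA cF; apply/(fsubsetP (sdom_adom A))/(mem_adom FA). Qed.

Lemma sat_role (A : structure) (h : var -> sdom A) x (d : sdom A) R :
  atom_map (fun y => val ([eta h with x.+1 |-> d] y)) (@Atom _ (R, 2) [tuple x; x.+1])
  = Atom (R := (R, 2)) [tuple val (h x); val d].
Proof.
apply: atom_eq => //; rewrite /aargs /= eqxx.
by rewrite ltn_eqF.
Qed.

Lemma sat_concept (A : structure) C (h : var -> sdom A) x :
  sat h (concept_fo C x) <-> csem (sinst A) C (val (h x)).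
Proof.
elim: C h x => //= [N|C IH|C IHC D IHD|C IHC D IHD|R C IH|R C IH] h x.
- rewrite (_ : atom_map _ _ = Atom (R := (N, 1)) [tuple val (h x)]) //.
  exact: atom_eq.
- by rewrite IH.
- by rewrite IHC IHD.
- by rewrite IHC IHD.
- split=> [[d [hR /IH]]|[d hR Cd]].
    by rewrite /= eqxx; exists (val d) => //; rewrite -sat_role.
  have dA : d \in sdom A by apply: (arg_sdom hR); rewrite !inE eqxx orbT.
  by exists [` dA]; split; [rewrite sat_role|apply/IH; rewrite /= eqxx].
- split=> H d hR.
    have dA : d \in sdom A by apply: (arg_sdom hR); rewrite !inE eqxx orbT.
    have := H [` dA]; rewrite sat_role => /(_ hR) /IH.
    by rewrite /= eqxx.
  by apply/IH; rewrite /= eqxx; apply: H; rewrite -sat_role.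
Qed.

Definition inclusion (CD : concept * concept) : fo :=
  FAll 0 (FImp (concept_fo CD.1 0) (concept_fo CD.2 0)).

Lemma ALC_inclusions (O : ontology) :
  List.Forall ALC O -> exists l, O = map inclusion l.
Proof.
elim => [|_ O' [C D] _ [l ->]]; first by exists [::].
by exists ((C, D) :: l).
Qed.

Lemma modelsP (A : structure) (l : seq (concept * concept)) :
  models A (map inclusion l) <->
  (forall CD, List.In CD l -> forall c, c \in sdom A ->
     csem (sinst A) CD.1 c -> csem (sinst A) CD.2 c).
Proof.
(* Assignments are total with values in the domain, so a default element is taken from its
   non-emptiness. *)
have [c0 c0A] := fset0Pn _ (sdom_neq0 A).
rewrite /models List.Forall_forall; split=> [H CD CDl c cA CD1|H _ /List.in_map_iff[CD [<- CDl]]].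
  pose h : var -> sdom A := [eta (fun=> [` c0A]) with 0 |-> [` cA]].
  have: sat h (concept_fo CD.1 0) -> sat h (concept_fo CD.2 0).
    exact: H _ (List.in_map inclusion _ _ CDl) (fun=> _) [` cA].
  by rewrite !sat_concept; apply.
move=> h d; set h' : var -> sdom A := [eta h with 0 |-> d].
suff: sat h' (concept_fo CD.1 0) -> sat h' (concept_fo CD.2 0) by [].
by rewrite !sat_concept; apply: H; last exact: valP.
Qed.

Lemma concept_fo_arity C x R : R \in fo_symbs (concept_fo C x) -> 0 < arity R.
Proof.
elim: C x => //= [N|C IHC D IHD|C IHC D IHD|S C IHC|S C IHC] x; last first.
- by rewrite in_cons => /predU1P[->|/IHC].
- by rewrite in_cons => /predU1P[->|/IHC].
- by rewrite mem_cat => /orP[/IHC|/IHD].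
- by rewrite mem_cat => /orP[/IHC|/IHD].
by rewrite inE => /eqP->.
Qed.

(** Rules out nullary facts, which would belong to no particular copy when models are glued. *)
Lemma sig_arity l R : R \in sig_of (map inclusion l) -> 0 < arity R.
Proof.
rewrite inE; elim: l => //= -[C D] l IHl.
by rewrite !mem_cat => /orP[/orP[]/concept_fo_arity|/IHl].
Qed.

Lemma UCQ_inv S n q : @UCQ S n q -> exists u : ucq n, q = ucq_eval u.
Proof. by case=> S' m u _; exists u. Qed.

Lemma MDDlog_inv S n q :
  @MDDlog S n q -> exists2 P : program n, mddlog P & S = edb P /\ q = program_eval P.
Proof. by case=> m P mP; exists P. Qed.

Lemma OMQ_inv L Q S n q : @OMQ L Q S n q ->
  exists (O : ontology) (q' : query n),
    [/\ List.Forall L O, Q (S `|` sig_of O) n q' & q = certain_answers S O q'].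
Proof. by case=> S' O m q' LO Qq; exists O, q'. Qed.

Lemma binary_arity S R : binary S -> R \in S -> 0 < arity R.
Proof. by move=> bS /bS[] ->. Qed.

(** * Predicates of monadic programs and a criterion for non-answers *)

Section Programs.
Variables (n : nat) (P : program n).
Hypothesis mP : mddlog P.

Lemma idbP R : reflect (exists r F, [/\ r \in rules P, F \in rule_head r & asymb F = R])
  (R \in idb P).
Proof.
rewrite inE; apply: (iffP flatten_mapP) => [[r rP /mapP[F Fr ->]]|[r [F [rP Fr <-]]]].
  by exists r, F.
by exists r => //; apply: map_f.
Qed.

Lemma head_idb r F : r \in rules P -> F \in rule_head r -> asymb F \in idb P.
Proof. by move=> rP Fr; apply/idbP; exists r, F. Qed.

Lemma body_not_goal r F : r \in rules P -> F \in rule_body r -> asymb F != goal P.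
Proof.
case: mP => + _ => /[apply] -[_ _ + _] Fr; apply: contraNneq => <-.
exact: map_f.
Qed.

Lemma body_idb_edb r F :
  r \in rules P -> F \in rule_body r -> asymb F \in idb P `|` edb P.
Proof.
move=> rP Fr; rewrite in_fsetU in_fsetD; case: (asymb F \in idb P) => //=.
by rewrite inE; apply/flatten_mapP; exists r => //; apply: map_f.
Qed.

Lemma goal_notin_edb : goal P \notin edb P.
Proof.
apply/negP => /fsetDP[+ _]; rewrite inE => /flatten_mapP[r rP /mapP[F Fr E]].
by have := body_not_goal rP Fr; rewrite -E eqxx.
Qed.

End Programs.

Lemma In_mem (T : eqType) (x : T) (s : seq T) : List.In x s <-> x \in s.
Proof.
elim: s => //= y s IHs; rewrite in_cons IHs; split=> [[->|->]|/predU1P[->|]];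
  rewrite ?eqxx ?orbT //.
  by left.
by right.
Qed.

(* It suffices to refute the program without goal facts: adding all goal facts
   except goal(a) then satisfies the goal rules. *)
Lemma not_program_eval n (P : program n) (I D : instance) (a : n.-tuple const) :
    mddlog P -> D `<=` I -> over_schema (idb P `|` edb P) I ->
    (forall F, F \in I -> asymb F != goal P) ->
    (forall r h, r \in rules P -> all (fun F => atom_map h F \in I) (rule_body r) ->
       has (fun F => if asymb F == goal P then map h (aargs F) != a :> seq const
                     else atom_map h F \in I) (rule_head r)) ->
  ~ program_eval P D a.
Proof.
move=> mP DI oI ngI rI [aD H].
pose goals : instance := [fset @Atom const (goal P) t | t in tuples_over n (adom I) `\ a].
(* If goal heads no rule, goal facts lie outside the schema of the program and must not be added. *)
pose goals' := if goal P \in idb P then goals else fset0.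
have goals'P t : goal P \in idb P ->
    (@Atom const (goal P) t \in goals') = (t \in tuples_over n (adom I) `\ a).
  move=> gP; rewrite /goals' gP; apply/imfsetP/idP => [[t' + /(congr1 aargs)]|tX]; last by exists t.
  by rewrite /aargs /= => + /val_inj ->.
have goals'g F : F \in goals' -> (goal P \in idb P) && (asymb F == goal P).
  by rewrite /goals'; case: ifP => // _ /imfsetP[t _ ->] /=.
have sub : I `<=` I `|` goals' by apply: fsubsetUl.
have: @Atom const (goal P) a \in I `|` goals'.
  apply: H; first exact: fsubset_trans DI sub.
    move=> F; rewrite in_fsetU => /orP[/oI//|/goals'g/andP[gP /eqP->]].
    by rewrite in_fsetU gP.
  move=> r rP h hb.
  (* Bodies contain no goal atom, so a body match already lies in [I]. *)
  have hbI : all (fun F => atom_map h F \in I) (rule_body r).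
    apply/allP => F Fr; have := allP hb F Fr; rewrite in_fsetU => /orP[//|/goals'g].
    by rewrite (negPf (body_not_goal mP rP Fr)) andbF.
  have /hasP[F Fr hF] := rI r h rP hbI; apply/hasP; exists F => //.
  case: eqP hF => [E hF|_ hF]; last by rewrite in_fsetU hF.
  have gP : goal P \in idb P by rewrite -E (head_idb rP).
  have sz : size (map h (aargs F)) == n by rewrite size_map size_aargs E.
  rewrite (_ : atom_map h F = @Atom const (goal P) (Tuple sz)); last exact: atom_eq.
  rewrite in_fsetU goals'P // in_fsetD1 -val_eqE hF /= orbC; apply/orP; left.
  (* Head variables occur in the body, so the derived goal tuple ranges over the active domain of
     [I]. *)
  apply/tuples_overP => _ /mapP[x xF ->].
  have [_ sv _ _] := mP.1 _ rP.
  have /vars_ofP[G Gr xG] : x \in vars_of (rule_body r) by apply/sv/vars_ofP; exists F.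
  by apply: (mem_adom (allP hbI G Gr)); apply: map_f.
rewrite in_fsetU => /orP[/ngI/eqP//|aG].
have /andP[gP _] := goals'g _ aG.
by move: aG; rewrite goals'P // in_fsetD1 eqxx.
Qed.

Lemma all_In (T : Type) (p : pred T) (s : seq T) :
  all p s <-> (forall x, List.In x s -> p x).
Proof.
elim: s => //= y s IHs; split=> [/andP[py /IHs ps] x [<-//|/ps//]|ps].
by apply/andP; split; [apply: ps; left|apply/IHs => x xs; apply: ps; right].
Qed.

(** * From MDDlog to ontology-mediated queries *)

Section OmqOfProgram.
Variables (n : nat) (P : program n).
Hypotheses (mP : mddlog P) (bP : binary (edb P)).

(** Shifting by a number beyond all names of the program makes the barred symbols fresh and keeps
    them pairwise distinct. *)
Definition bar_shift : nat :=
  fresh_name (goal P :: enum_fset (idb P `|` edb P)).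
Definition bar (R : symb) : symb := ((R.1 + bar_shift)%N, R.2).
Definition bar_atom V (F : atom V) : atom V := @Atom V (bar (asymb F)) (tagged F).

Lemma bar_inj : injective bar.
Proof. by move=> [A k] [B m] [/addIn-> ->]. Qed.

Lemma bar_fresh R : bar R \notin idb P `|` edb P.
Proof.
apply/negP => barR; suff: (bar R).1 < bar_shift by rewrite /= ltnNge leq_addl.
by apply: ltn_fresh_name; rewrite inE barR orbT.
Qed.

Lemma atom_map_bar V W (h : V -> W) (F : atom V) :
  atom_map h (bar_atom F) = bar_atom (atom_map h F).
Proof. by []. Qed.

Lemma bar_atom_inj V : injective (@bar_atom V).
Proof.
move=> F G E; apply: atom_eq; last by rewrite -[aargs F]/(aargs (bar_atom F)) E.
by apply: bar_inj; rewrite -[bar _]/(asymb (bar_atom F)) E.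
Qed.

Definition guessed : {fset symb} := [fset R in idb P | R != goal P].
Definition guess_ontology : ontology :=
  [seq inclusion (CTop, COr (CName R.1) (CName (bar R).1)) | R <- enum_fset guessed].

Lemma mem_guessed R : (R \in guessed) = (R \in idb P) && (R != goal P).
Proof. by rewrite !inE. Qed.

Lemma guessed_arity R : R \in guessed -> R = (R.1, 1).
Proof.
rewrite mem_guessed => /andP[RP Rg]; rewrite {1}(surjective_pairing R).
by rewrite (_ : R.2 = 1) //; apply: mP.2.
Qed.

Lemma sig_guess R :
  (R \in sig_of guess_ontology) = (R \in guessed) || [exists R' : guessed, R == bar (val R')].
Proof.
rewrite inE /guess_ontology -map_comp.
apply/flatten_mapP/orP => [[R' R'g]|[Rg|/existsP[[R' R'g] /= /eqP->]]].
- rewrite /= !in_cons in_nil orbF => /orP[] /eqP->; first by left; rewrite -guessed_arity.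
  right; apply/existsP; exists [` R'g].
  by rewrite /bar /= [X in (_, X.2)](guessed_arity R'g).
- by exists R => //=; rewrite inE -guessed_arity ?eqxx.
by exists R' => //=; rewrite !inE /bar (guessed_arity R'g) eqxx orbT.
Qed.

Lemma guessed_atom V (F : atom V) : asymb F \in guessed ->
  exists x, F = @Atom V ((asymb F).1, 1) [tuple x].
Proof.
move=> /guessed_arity E; have /eqP := size_aargs F; rewrite E eqn_leq.
case Ea: (aargs F) => [|x [|y s]] // _; exists x.
exact: atom_eq.
Qed.

Lemma models_guess (A : structure) :
  models A guess_ontology <->
  (forall F : fact, asymb F \in guessed -> {subset aargs F <= sdom A} ->
     F \in sinst A \/ bar_atom F \in sinst A).
Proof.
pose guess (R : symb) := (CTop, COr (CName R.1) (CName (bar R).1)).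
rewrite /guess_ontology (map_comp inclusion guess) modelsP.
split=> [H F Fg FA|H _ /List.in_map_iff[R [<- /In_mem Rg]] c cA _ /=].
  have [c E] := guessed_atom Fg.
  have := H (guess (asymb F)) (List.in_map guess _ _ (iffRL (In_mem _ _) Fg)) c.
  rewrite /= -[@Atom _ (_, 1) _]E (_ : Atom _ = bar_atom F).
    by apply=> //; apply: FA; rewrite E mem_head.
  by rewrite E.
apply: (H (@Atom const (R.1, 1) [tuple c])); first by rewrite -[asymb _]/(R.1, 1) -guessed_arity.
by move=> _ /[!inE]/eqP->.
Qed.

(** * The query asking for a violated rule *)

Section Violation.
Variable r : rule.

Let xs := vars_of (rule_body r).
(** The type ['I_(size xs).-1.+1] is inhabited even for empty [xs], as [inord] requires, and has
    [size xs] elements once [xs] is non-empty. *)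
Definition violation_var (x : var) : 'I_(size xs).-1.+1 := inord (index x xs).

(** In the goal case the list of arguments has length [n], so the default of [nth] is never
    reached. *)
Definition violation_head (F : atom var) : seq (literal ('I_n + 'I_(size xs).-1.+1)) :=
  if asymb F == goal P
  then [seq LEq (inl i) (inr (violation_var (nth 0 (aargs F) i))) | i : 'I_n <- enum 'I_n]
  else [:: LRel (bar_atom (atom_map (inr \o violation_var) F))].

Definition violation_cq : cq n :=
  @CQ n (size xs).-1.+1
    ([seq LRel (atom_map (inr \o violation_var) F) | F <- rule_body r] ++
     flatten [seq violation_head F | F <- rule_head r]).

Definition head_fails (D : instance) (a : n.-tuple const) (h : var -> const) (F : atom var) :=
  if asymb F == goal P then map h (aargs F) == a :> seq const
  else bar_atom (atom_map h F) \in D.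

Lemma violation_bodyE (D : instance) (a : n.-tuple const) b :
  let h x := tnth b (violation_var x) in
  all (literal_holds D (cq_assign a b)) (cq_body violation_cq) =
  all (fun F => atom_map h F \in D) (rule_body r) && all (head_fails D a h) (rule_head r).
Proof.
move=> h; rewrite all_cat all_map; congr andb.
  by apply: eq_all => F /=; rewrite atom_map_comp.
elim: (rule_head r) => //= F s <-.
rewrite all_cat; congr andb; rewrite /violation_head /head_fails.
case: eqP => [E|_]; last by rewrite /= andbT atom_map_bar atom_map_comp.
have sF : size (aargs F) = n by rewrite size_aargs E.
rewrite all_map; apply/allP/eqP => [H|E' i _ /=].
  apply: (@eq_from_nth _ 0); first by rewrite size_map sF size_tuple.
  rewrite size_map sF => i ltin.
  rewrite (nth_map 0) ?sF //.
  have /eqP := H (Ordinal ltin) (mem_enum _ _).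
  by rewrite /= (tnth_nth 0) => ->.
by rewrite (tnth_nth 0) -E' (nth_map 0) // sF.
Qed.

Hypothesis rP : r \in rules P.

(** Guarantees that a rule body, being non-empty, contains a variable. *)
Lemma body_arity F : F \in rule_body r -> 0 < arity (asymb F).
Proof.
move=> Fr; have := body_idb_edb rP Fr; rewrite in_fsetU => /orP[/mP.2|/binary_arity->//].
by move=> /(_ (body_not_goal mP rP Fr)) ->.
Qed.

Lemma violation_varK x : x \in xs -> nth 0 xs (violation_var x) = x.
Proof.
move=> xxs; rewrite inordK ?nth_index // prednK ?index_mem //.
by case: xs xxs.
Qed.

Lemma violationP (D : instance) (a : n.-tuple const) :
  cq_eval violation_cq D a <-> {subset a <= adom D} /\
  exists2 h, all (fun F => atom_map h F \in D) (rule_body r) & all (head_fails D a h) (rule_head r).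
Proof.
split=> -[aD].
  by case=> b _; rewrite violation_bodyE => /andP[]; split=> //; eexists; eassumption.
case=> h hb hh; split=> //; have [body0 sub _ _] := mP.1 _ rP.
have xs_gt0 : 0 < size xs.
  case E: (rule_body r) body0 => [|F s] // _.
  have /body_arity : F \in rule_body r by rewrite E mem_head.
  by rewrite /xs /vars_of E /= size_cat -size_aargs; apply: ltn_addr.
(* Every entry is the value of a body variable, hence in the active domain; a repeated variable is
   read at its first occurrence only. *)
pose b := [tuple h (nth 0 xs i) | i < (size xs).-1.+1].
have bE : {in xs, forall x, tnth b (violation_var x) = h x}.
  by move=> x xxs; rewrite tnth_mktuple violation_varK.
exists b => [c /mapP[i _ ->]|].
  have /vars_ofP[F Fr xF] : nth 0 xs i \in xs by rewrite mem_nth // -[X in _ < X]prednK.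
  by apply: (mem_adom (allP hb F Fr)); apply: map_f.
rewrite violation_bodyE; apply/andP; split; apply/allP => F Fr.
  rewrite (@eq_in_atom_map _ _ _ h) ?(allP hb) // => x xF; apply: bE.
  by apply/vars_ofP; exists F.
have hE : {in aargs F, (fun x => tnth b (violation_var x)) =1 h}.
  by move=> x xF; apply/bE/sub/vars_ofP; exists F.
have := allP hh F Fr; rewrite /head_fails (eq_in_atom_map hE).
by have /eq_in_map-> := hE.
Qed.

Lemma violation_symbs R : R \in cq_symbs violation_cq -> R \in edb P `|` sig_of guess_ontology.
Proof.
rewrite in_fsetU sig_guess /cq_symbs map_cat flatten_cat mem_cat => /orP[].
  rewrite -map_comp => /flatten_mapP[F Fr]; rewrite inE => /eqP->.
  have := body_idb_edb rP Fr; rewrite in_fsetU mem_guessed (body_not_goal mP rP Fr) andbT.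
  by case/orP=> -> //; rewrite orbT.
rewrite /cq_body /=; elim: (rule_head r) (fun F => @head_idb n P r F rP) => //= F s IHs hs.
rewrite map_cat flatten_cat mem_cat => /orP[|]; last first.
  by apply: IHs => G Gs; apply: hs; rewrite in_cons Gs orbT.
rewrite /violation_head; case: eqP => [_|/eqP Fg].
  by rewrite -map_comp => /flatten_mapP[].
rewrite inE => /eqP->; apply/orP; right; apply/orP; right; apply/existsP.
have Fgu : asymb F \in guessed by rewrite mem_guessed Fg hs // mem_head.
by exists [` Fgu].
Qed.

End Violation.

Definition violation_ucq : ucq n := [seq violation_cq r | r <- rules P].

Lemma violation_ucqP (D : instance) (a : n.-tuple const) :
  ucq_eval violation_ucq D a <-> {subset a <= adom D} /\
  exists r h, [/\ r \in rules P, all (fun F => atom_map h F \in D) (rule_body r)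
                & all (head_fails D a h) (rule_head r)].
Proof.
rewrite /ucq_eval List.Exists_exists; split.
  case=> _ [/List.in_map_iff[r [<- /In_mem rP]] /(violationP rP)[aD [h hb hh]]].
  by split=> //; exists r, h.
case=> aD [r [h [rP hb hh]]]; exists (violation_cq r); split.
  by apply/(List.in_map violation_cq)/In_mem.
by apply/violationP => //; split=> //; exists h.
Qed.

Lemma violation_ucq_symbs :
  {subset ucq_symbs violation_ucq <= edb P `|` sig_of guess_ontology}.
Proof.
move=> R; rewrite /ucq_symbs /violation_ucq -map_comp => /flatten_mapP[r rP].
exact: violation_symbs.
Qed.

(** If the query fails in a model of the ontology, the facts over non-goal program symbols refute
    the program: a missing non-goal head atom is barred in the model, so a body match without a
    suitable head would be a violation. *)
Lemma program_certain (D : instance) (a : n.-tuple const) : over_schema (edb P) D ->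
  program_eval P D a -> certain_answers (edb P) guess_ontology (ucq_eval violation_ucq) D a.
Proof.
move=> oD PDa; have aD := PDa.1; split=> // A _ /models_guess mA DA.
apply: contrapT => nq; move: PDa.
pose I : instance := [fset F in sinst A | (asymb F \in idb P `|` edb P) && (asymb F != goal P)].
have memI F : (F \in I) = [&& F \in sinst A, asymb F \in idb P `|` edb P & asymb F != goal P].
  by rewrite in_fset.
apply: (@not_program_eval _ _ I) => //.
- apply/fsubsetP => F FD; rewrite memI (fsubsetP DA) // in_fsetU oD // orbT /=.
  by apply: contraTneq (oD _ FD) => ->; apply: goal_notin_edb.
- by move=> F; rewrite memI => /and3P[].
- by move=> F; rewrite memI => /and3P[].
move=> r h rP hb; have hbA : all (fun F => atom_map h F \in sinst A) (rule_body r).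
  by apply/allP => F /(allP hb); rewrite memI => /andP[].
have aA : {subset a <= adom (sinst A)} by move=> c /aD; apply: adomS.
apply: contrapT => /negP; rewrite -all_predC => hh; apply: nq; apply/violation_ucqP; split=> //.
exists r, h; split=> //; apply/allP => F Fr; have /= := allP hh F Fr; rewrite /head_fails.
case: ifPn => [_|Fg]; first by rewrite negbK.
have Fidb := head_idb rP Fr.
rewrite memI in_fsetU Fidb Fg !andbT => nFA.
case: (mA (atom_map h F)) => [||FA|//]; first by rewrite mem_guessed Fidb.
  move=> _ /mapP[x xF ->]; have [_ sv _ _] := mP.1 _ rP.
  have /vars_ofP[G Gr xG] : x \in vars_of (rule_body r) by apply/sv/vars_ofP; exists F.
  by apply: (arg_sdom (allP hbA G Gr)); apply: map_f.
by rewrite FA in nFA.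
Qed.

(** A model [D'] of the rules becomes a model of the ontology by dropping goal facts and barring
    exactly the missing guessed atoms. The violated rule found there has a true head atom in [D'],
    which can only be goal(a). *)
Lemma certain_program (D : instance) (a : n.-tuple const) : over_schema (edb P) D ->
  certain_answers (edb P) guess_ontology (ucq_eval violation_ucq) D a -> program_eval P D a.
Proof.
move=> oD [aD H]; split=> // D' DD' oD' rD'.
(* The element 0 keeps the domain non-empty when [D'] has no constants. *)
pose dom := adom D' `|` [fset 0].
pose unary (p : symb * const) := @Atom const (p.1.1, 1) [tuple p.2].
pose fresh := [fset bar_atom (unary p) | p in guessed `*` dom & unary p \notin D'].
pose I : instance := [fset F in D' | asymb F != goal P] `|` fresh.
have freshP F : F \in fresh -> exists G,
    [/\ F = bar_atom G, asymb G \in guessed, G \notin D' & {subset aargs G <= dom}].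
  case/imfsetP => -[R c] /= /andP[]; rewrite in_fsetM /= => /andP[Rg cd] nD ->.
  by exists (unary (R, c)); split=> //;
    [rewrite -[asymb _]/(R.1, 1) -guessed_arity|move=> _ /[!inE]/eqP->; rewrite !inE in cd *].
have memI F : (F \in I) = (F \in D') && (asymb F != goal P) || (F \in fresh).
  by rewrite in_fsetU in_fset.
have dom0 : dom != fset0 by apply/fset0Pn; exists 0; rewrite in_fsetU in_fset1 eqxx orbT.
have domI : adom I `<=` dom.
  apply/fsubsetP => c /adomP[F + cF]; rewrite memI => /orP[/andP[FD _]|].
    by rewrite in_fsetU (mem_adom FD).
  by case/freshP=> G [E _ _]; apply; rewrite E in cF.
pose A := Structure dom0 domI.
have /violation_ucqP[_ [r [h [rP hb hh]]]] : ucq_eval violation_ucq (sinst A) a.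
  apply: H.
  - move=> F /=; rewrite memI in_fsetU sig_guess => /orP[/andP[FD Fg]|].
      by have := oD' F FD; rewrite in_fsetU mem_guessed Fg andbT => /orP[->|->] //; rewrite orbT.
    case/freshP => G [-> Gg _ _]; apply/orP; right; apply/orP; right.
    by apply/existsP; exists [` Gg].
  - apply/models_guess => F Fg FA; case FD: (F \in D').
      left; rewrite /= memI FD; move: Fg.
      by rewrite mem_guessed => /andP[_ ->].
    right; rewrite /= memI; apply/orP; right.
    have [c E] := guessed_atom Fg; have uE : unary (asymb F, c) = F by rewrite [RHS]E.
    apply/imfsetP; exists (asymb F, c); last by rewrite uE.
    apply/andP; split; last by rewrite uE FD.
    by rewrite in_fsetM Fg; apply: FA; rewrite E mem_head.
  apply/fsubsetP => F FD; rewrite /= memI (fsubsetP DD' _ FD) /=.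
  by apply/orP; left; apply: contraTneq (oD _ FD) => ->; apply: goal_notin_edb.
have hbD : all (fun F => atom_map h F \in D') (rule_body r).
  apply/allP => F Fr; have := allP hb F Fr; rewrite /= memI => /orP[/andP[]//|/freshP[G [E _ _ _]]].
  have := body_idb_edb rP Fr; rewrite -[asymb F]/(asymb (atom_map h F)) E.
  by rewrite (negPf (bar_fresh _)).
have /hasP[F Fr FD] := rD' r rP h hbD; have := allP hh F Fr; rewrite /head_fails.
case: eqP => [E /eqP ha|/eqP Fg /=].
  by rewrite (_ : @Atom const (goal P) a = atom_map h F) //; apply: atom_eq.
rewrite memI => /orP[/andP[/oD']|/freshP[G [/bar_atom_inj <- _]]]; last by rewrite FD.
by rewrite (negPf (bar_fresh _)).
Qed.

End OmqOfProgram.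

(** * From ontology-mediated queries to MDDlog *)

Fixpoint subconcepts (C : concept) : seq concept :=
  C :: match C with
       | CNot C | CEx _ C | CAll _ C => subconcepts C
       | CAnd C D | COr C D => subconcepts C ++ subconcepts D
       | _ => [::]
       end.

Definition literal_args V (l : literal V) : seq V :=
  match l with LRel F => aargs F | LEq x y => [:: x; y] end.

(* The variables in V0 sit at the root c, the others anywhere. The root is allowed
   as a value even outside the active domain, so that the variables the mask does
   not mention can be sent there. *)
Definition rooted_query n (p : cq n) (m : bitseq) (V0 : {set 'I_n + 'I_(cq_nex p)})
    (I : instance) (c : const) : Prop :=
  exists g : 'I_n + 'I_(cq_nex p) -> const,
    [/\ {in V0, forall v, g v = c}, forall v, g v \in adom I \/ g v = c
      & all (literal_holds I g) (mask m (cq_body p))].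

Definition rooted_queries n (p : cq n) : seq (instance -> const -> Prop) :=
  [seq rooted_query (p := p) x.1 x.2
     | x : (size (cq_body p)).-tuple bool * {set 'I_n + 'I_(cq_nex p)}
         <- enum {: (size (cq_body p)).-tuple bool * {set 'I_n + 'I_(cq_nex p)}}].

Section ProgramOfOmq.
Variables (S : schema) (n : nat) (l : seq (concept * concept)) (u : ucq n).
Hypothesis bS : binary S.

Definition relevant_concepts : seq concept :=
  flatten [seq subconcepts CD.1 ++ subconcepts CD.2 | CD <- l].

Definition properties : seq (instance -> const -> Prop) :=
  [seq csem^~ C | C <- relevant_concepts] ++ flatten [seq rooted_queries p | p <- u].

(** Recording truth values as Booleans puts profiles in a finite type, so a rule head can list them
    all. *)
Definition profile (I : instance) (c : const) : (size properties).-tuple bool :=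
  map_tuple (fun Q => `[< Q I c >]) (in_tuple properties).

Lemma profile_eq I J c d Q :
  profile I c = profile J d -> List.In Q properties -> Q I c <-> Q J d.
Proof.
move=> /(congr1 val) /=; elim: properties => //= Q' s IHs [EQ Es] [<-|/IHs->//].
by split=> /asboolP; [rewrite EQ|rewrite -EQ] => /asboolP.
Qed.

Lemma profile_csem I J c d C : profile I c = profile J d -> List.In C relevant_concepts ->
  csem I C c <-> csem J C d.
Proof.
move=> E HC; apply: (profile_eq (Q := csem^~ C) E).
by apply/List.in_app_iff; left; apply: (List.in_map (fun C I c => csem I C c)).
Qed.

(** The literals falling into one copy are singled out by a predicate, and every predicate yields
    one of the finitely many masks recorded in the profile. *)
Lemma profile_rooted I J c d p (P : pred (literal ('I_n + 'I_(cq_nex p)))) V0 :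
  profile I c = profile J d -> List.In p u ->
  rooted_query (p := p) (map P (cq_body p)) V0 I c <->
  rooted_query (p := p) (map P (cq_body p)) V0 J d.
Proof.
move=> E Hp; apply: (profile_eq E); apply/List.in_app_iff; right.
have: List.In (rooted_query (p := p) (map P (cq_body p)) V0) (rooted_queries p).
  pose m := map_tuple P (in_tuple (cq_body p)).
  apply: (List.in_map (fun x : (size (cq_body p)).-tuple bool * {set 'I_n + 'I_(cq_nex p)} =>
    rooted_query (p := p) x.1 x.2) _ (m, V0)).
  by apply/In_mem; rewrite mem_enum.
elim: u Hp => //= p' s IHs [->|/IHs IH] H; apply/List.in_app_iff; [by left|by right; apply: IH].
Qed.

(** * Realized profiles and coloured instances *)

Definition ontology_structure (A : structure) : Prop :=
  over_schema (S `|` sig_of (map inclusion l)) (sinst A) /\ models A (map inclusion l).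

Definition realized t : Prop := exists A c,
  [/\ ontology_structure A, c \in adom (sinst A) & profile (sinst A) c = t].
Definition profiles : seq ((size properties).-tuple bool) :=
  [seq t <- enum predT | `[< realized t >]].

Lemma mem_profiles t : t \in profiles <-> realized t.
Proof. by rewrite mem_filter mem_enum andbT; split=> /asboolP. Qed.

(** The name [base] itself goes to the goal predicate; profile symbols take names beyond it. *)
Definition base := fresh_name (enum_fset S).
Definition profile_symb (t : (size properties).-tuple bool) : symb :=
  ((base.+1 + choice.pickle t)%N, 1).
Definition profile_atom V t (x : V) : atom V := @Atom V (profile_symb t) [tuple x].

Lemma atom_map_profile V W (h : V -> W) t x : atom_map h (profile_atom t x) = profile_atom t (h x).
Proof. exact: atom_eq. Qed.

Lemma profile_atom_inj V t t' (x x' : V) : profile_atom t x = profile_atom t' x' ->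
  t = t' /\ x = x'.
Proof.
move=> E; have [] : profile_symb t = profile_symb t' /\ [:: x] = [:: x'].
  by rewrite -[profile_symb t]/(asymb (profile_atom t x)) -[[:: x]]/(aargs (profile_atom t x)) E.
by move=> [/addnI/(pcan_inj choice.pickleK)->] [->].
Qed.

Lemma schema_name R : R \in S -> R.1 < base.
Proof. by move=> RS; apply: ltn_fresh_name. Qed.

Lemma profile_symb_schema t : profile_symb t \notin S.
Proof. by apply/negP => /schema_name; rewrite ltnNge /= addSn leqW // leq_addr. Qed.

(** The intended guess of the program: the data part of a model, each constant marked with its true
    profile. *)
Definition colored (I : instance) : instance :=
  [fset F in I | asymb F \in S] `|` [fset profile_atom (profile I c) c | c in adom I].

Lemma mem_colored I F : F \in colored I <->
  (F \in I /\ asymb F \in S) \/ (exists2 c, c \in adom I & F = profile_atom (profile I c) c).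
Proof.
rewrite in_fsetU in_fset; split=> [/orP[/andP[]|/imfsetP[c]]|[[FI FS]|[c cI ->]]].
- by left.
- by right; exists c.
- by apply/orP; left; apply/andP.
by apply/orP; right; apply/imfsetP; exists c.
Qed.

Lemma colored_schema I F : F \in colored I -> asymb F \in S -> F \in I.
Proof. by move=> /mem_colored[[]//|[c _ ->]] /(negP (profile_symb_schema _)). Qed.

Lemma colored_profile I t c : profile_atom t c \in colored I <-> c \in adom I /\ profile I c = t.
Proof.
split=> [/mem_colored[[_ /(negP (profile_symb_schema t))[]]|[d dI E]]|[cI <-]].
  by have [-> ->] := profile_atom_inj E.
by apply/mem_colored; right; exists c.
Qed.

(** * Bounded patterns and the rules of the program *)

(* One variable per variable of a conjunctive query; two more beyond the answer
   variables for the end points of a data edge in [relevant_consistent]. *)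
Definition pattern_vars := (n + \max_(k <- [seq cq_nex p | p <- u]) k).+2.

Lemma cq_nex_pattern p : List.In p u -> n + cq_nex p <= pattern_vars.
Proof.
move=> Hp; do 2!apply: leqW; rewrite leq_add2l.
by apply: (@leq_bigmax_seq _ _ xpredT id) => //; apply/In_mem/List.in_map.
Qed.

(** Conjunction ignores order and repetition, so the masks of this list yield all bodies over the
    bounded set of variables. *)
Definition pattern_atoms : seq (atom var) :=
  flatten [seq [seq @Atom var R (map_tuple val t)
                | t : (arity R).-tuple 'I_pattern_vars <- enum predT]
          | R <- enum_fset S ++ map profile_symb profiles].

Lemma pattern_atoms_symb F : F \in pattern_atoms ->
  asymb F \in S \/ asymb F \in map profile_symb profiles.
Proof.
case/flatten_mapP => R; rewrite mem_cat => /orP RS /mapP[t _ ->].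
by case: RS; [left|right].
Qed.

Lemma mem_pattern_atoms F : (asymb F \in S) || (asymb F \in map profile_symb profiles) ->
  {in aargs F, forall x, x < pattern_vars} -> F \in pattern_atoms.
Proof.
case: F => R t; rewrite /asymb /aargs /= => RS lt.
apply/flatten_mapP; exists R; first by rewrite mem_cat.
apply/mapP; exists (map_tuple inord t); first by rewrite mem_enum.
congr Tagged; apply: val_inj; rewrite /= -map_comp -[LHS]map_id.
by apply/eq_in_map => x /lt ltx /=; rewrite inordK.
Qed.

(** A semantic condition, decided classically in [proper_pattern]; it admits exactly the goal rules
    that never derive a wrong answer in a coloured model. *)
Definition sound_pattern (xs : n.-tuple 'I_pattern_vars) (body : seq (atom var)) : Prop :=
  forall A (h : var -> const), ontology_structure A ->
    all (fun F => atom_map h F \in colored (sinst A)) body ->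
    ucq_eval u (sinst A) (map_tuple (fun i : 'I_pattern_vars => h i) xs).

(** Every data constant occupies a position of some fact, so one rule per position suffices. If no
    profile is realized, the head is empty, and indeed no data containing a constant has a model. *)
Definition guess_rule (R : symb) (i : 'I_(arity R)) : rule :=
  ([seq profile_atom t (val i) | t <- profiles], [:: @Atom var R [tuple val i | i < arity R]]).
(* A tautology, which makes every profile symbol an IDB predicate even over the
   empty schema. *)
Definition keep_rule t : rule := ([:: profile_atom t 0], [:: profile_atom t 0]).
Definition pattern_rule (xs : n.-tuple 'I_pattern_vars) (body : seq (atom var)) : rule :=
  ([:: @Atom var (base, n) (map_tuple val xs)], body).
Definition proper_pattern (xs : n.-tuple 'I_pattern_vars) (body : seq (atom var)) : bool :=
  [&& `[< sound_pattern xs body >], body != [::]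
    & all (fun i : 'I_pattern_vars => val i \in vars_of body) xs].

Definition omq_program : program n := Program n base
  (flatten [seq [seq guess_rule i | i <- enum 'I_(arity R)] | R <- enum_fset S] ++
   map keep_rule profiles ++
   [seq pattern_rule x.1 (mask x.2 pattern_atoms)
      | x : n.-tuple 'I_pattern_vars * (size pattern_atoms).-tuple bool
          <- enum predT & proper_pattern x.1 (mask x.2 pattern_atoms)]).

Variant omq_rule_spec : rule -> Prop :=
  | OmqGuess R (i : 'I_(arity R)) of R \in S : omq_rule_spec (guess_rule i)
  | OmqKeep t of t \in profiles : omq_rule_spec (keep_rule t)
  | OmqPattern xs body of proper_pattern xs body & {subset body <= pattern_atoms} :
      omq_rule_spec (pattern_rule xs body).

Lemma omq_ruleP r : r \in rules omq_program -> omq_rule_spec r.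
Proof.
rewrite !mem_cat => /or3P[/flatten_mapP[R RS /mapP[i _ ->]]|/mapP[t tp ->]|/mapP[[xs m]]].
- by constructor.
- by constructor.
rewrite mem_filter => /andP[pp _] ->; constructor => //.
by move=> F /mem_mask.
Qed.

Lemma guess_rule_in R (i : 'I_(arity R)) : R \in S -> guess_rule i \in rules omq_program.
Proof.
move=> RS; rewrite mem_cat; apply/orP; left; apply/flatten_mapP; exists R => //.
by apply: map_f; rewrite mem_enum.
Qed.

Lemma keep_rule_in t : t \in profiles -> keep_rule t \in rules omq_program.
Proof. by move=> tp; rewrite !mem_cat map_f ?orbT. Qed.

Lemma pattern_rule_in xs (p : pred (atom var)) : proper_pattern xs (filter p pattern_atoms) ->
  pattern_rule xs (filter p pattern_atoms) \in rules omq_program.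
Proof.
rewrite filter_mask => pp; rewrite !mem_cat; apply/or3P/Or33/mapP.
exists (xs, map_tuple p (in_tuple pattern_atoms)) => //.
by rewrite mem_filter mem_enum pp.
Qed.

Lemma goal_not_profile t : profile_symb t != goal omq_program.
Proof. by apply/eqP => -[/eqP]; rewrite gtn_eqF // leq_addr. Qed.

Lemma omq_idb R :
  R \in idb omq_program -> R = goal omq_program \/ R \in map profile_symb profiles.
Proof.
case/idbP => r [F [/omq_ruleP[R' i _|t tp|xs b _ _] Fr <-]].
- by right; case/mapP: Fr => t tp ->; apply: map_f.
- by right; move: Fr; rewrite inE => /eqP->; apply: map_f.
by left; move: Fr; rewrite inE => /eqP->.
Qed.

Lemma profile_idb t : t \in profiles -> profile_symb t \in idb omq_program.
Proof.
move=> tp; apply/idbP; exists (keep_rule t), (profile_atom t 0).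
by split=> //; [apply: keep_rule_in|apply: mem_head].
Qed.

Lemma schema_not_idb R : R \in S -> R \notin idb omq_program.
Proof.
move=> RS; apply/negP => /omq_idb[E|/mapP[t _ E]].
  by have := schema_name RS; rewrite E ltnn.
by have := profile_symb_schema t; rewrite -E RS.
Qed.

Lemma omq_body r F : r \in rules omq_program -> F \in rule_body r ->
  asymb F \in S \/ asymb F \in map profile_symb profiles.
Proof.
case/omq_ruleP => [R i RS|t tp|xs b _ sb] /=.
- by rewrite inE => /eqP->; left.
- by rewrite inE => /eqP->; right; apply: map_f.
by move/sb/pattern_atoms_symb.
Qed.

(** A data symbol has an argument position, hence a guess rule with it in the body; the profile
    symbols drop out as IDB predicates. *)
Lemma omq_edb : edb omq_program = S.
Proof.
apply/fsetP => R; rewrite in_fsetD; apply/andP/idP => [[nR]|RS].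
  rewrite inE => /flatten_mapP[r rP /mapP[F Fr E]].
  case: (omq_body rP Fr); rewrite -E // => /mapP[t tp Et].
  by rewrite Et profile_idb in nR.
split; first exact: schema_not_idb.
have R0 := binary_arity bS RS; rewrite inE; apply/flatten_mapP.
exists (guess_rule (Ordinal R0)); first exact: guess_rule_in.
exact: mem_head.
Qed.

Lemma omq_mddlog : mddlog omq_program.
Proof.
split=> [r rP|R /omq_idb[->/eqP//|/mapP[t _ ->]//]].
split.
- by case/omq_ruleP: rP => // xs b /and3P[].
- case/omq_ruleP: rP => [R i RS|t tp|xs b /and3P[_ _ sx] _] x //.
    case/vars_ofP => F /mapP[t _ ->]; rewrite inE => /eqP->.
    apply/vars_ofP; exists (@Atom var R [tuple val i | i < arity R]); first exact: mem_head.
    by apply/mapP; exists i => //; rewrite mem_enum.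
  case/vars_ofP => F /[!inE]/eqP-> /mapP[i ix ->].
  exact: (allP sx).
- apply/negP => /mapP[F Fr E]; case: (omq_body rP Fr); rewrite -E.
    by move/schema_name; rewrite ltnn.
  by case/mapP=> t _ /eqP; rewrite eq_sym (negPf (goal_not_profile t)).
case/omq_ruleP: rP => [R i RS|//|//] /mapP[F /mapP[t _ ->]] /eqP.
by rewrite eq_sym (negPf (goal_not_profile t)).
Qed.

(** A model refuting the query, coloured with its true profiles, satisfies the guess rules; a sound
    pattern matching in it only derives true answers, so never goal(a). *)
Lemma omq_program_certain (D : instance) (a : n.-tuple const) : over_schema S D ->
  program_eval omq_program D a -> certain_answers S (map inclusion l) (ucq_eval u) D a.
Proof.
move=> oD PDa; have aD := PDa.1; split=> // A oA mA DA; apply: contrapT => nu; move: PDa.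
apply: (@not_program_eval _ _ (colored (sinst A))) => //.
- exact: omq_mddlog.
- by apply/fsubsetP => F FD; apply/mem_colored; left; rewrite (fsubsetP DA) ?oD.
- move=> F /mem_colored[[_ FS]|[c cA ->]]; rewrite in_fsetU.
    by rewrite omq_edb FS orbT.
  by rewrite profile_idb //; apply/mem_profiles; exists A, c.
- move=> F /mem_colored[[_ FS]|[c cA ->]]; last exact: goal_not_profile.
  by apply: contraTneq FS => ->; apply/negP => /schema_name; rewrite ltnn.
move=> r h /omq_ruleP[R i RS|t tp|xs b /and3P[/asboolP sb _ _] _] /=.
- rewrite andbT => /colored_schema/(_ RS) hF.
  have hi : h i \in adom (sinst A).
    by apply: (mem_adom hF); apply: map_f; apply/mapP; exists i => //; rewrite mem_enum.
  apply/hasP; exists (profile_atom (profile (sinst A) (h i)) (val i)).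
    by apply: map_f; apply/mem_profiles; exists A, (h i).
  by rewrite (negPf (goal_not_profile _)) atom_map_profile; apply/colored_profile.
- by rewrite andbT orbF (negPf (goal_not_profile _)).
move=> hb; rewrite orbF eqxx; apply/eqP => E; apply: nu.
suff -> : a = map_tuple (fun i : 'I_pattern_vars => h i) xs by apply: sb.
by apply: val_inj; rewrite -[val a]E /aargs /= -map_comp.
Qed.

(* The instances of the pattern rules that do not derive goal(a) are exactly the
   small patterns of the coloured data with a refuting model. *)
Lemma refuting_structure (D D' : instance) (a : n.-tuple const) (s : seq const)
    (tD : const -> (size properties).-tuple bool) (d0 : const) :
    over_schema S D -> D `<=` D' ->
    (forall r, r \in rules omq_program -> rule_holds D' r) ->
    @Atom const (base, n) a \notin D' ->
    {in adom D, forall c, tD c \in profiles /\ profile_atom (tD c) c \in D'} ->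
    d0 \in adom D -> {subset a <= s} -> {subset s <= adom D} -> size s <= pattern_vars ->
  exists A (f : const -> const),
    [/\ ontology_structure A,
        forall F, F \in D -> {subset aargs F <= s} -> atom_map f F \in sinst A,
        {in s, forall c, f c \in adom (sinst A) /\ profile (sinst A) (f c) = tD c}
      & ~ ucq_eval u (sinst A) (map_tuple f a)].
Proof.
move=> oD DD' rD' aD' tDP d0D as_ sD ss.
(* Variable i stands for the i-th constant of [s]; variables beyond [s] stand for [d0], which
   carries a guessed profile too. *)
pose h i := nth d0 s i.
have hD i : h i \in adom D.
  by rewrite /h; case: (ltnP i (size s)) => [/(mem_nth d0)/sD|/(nth_default d0)->].
(* The body is the full description of [s]: all its data atoms together with the guessed profile of
   each variable. *)
pose keep (F : atom var) := (atom_map h F \in D) ||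
  has (fun i => F == profile_atom (tD (h i)) i) (iota 0 pattern_vars).
pose body := filter keep pattern_atoms.
have idx c : c \in s -> index c s < pattern_vars.
  by move=> cs; apply: leq_trans ss; rewrite index_mem.
have body_profile i : i < pattern_vars -> profile_atom (tD (h i)) i \in body.
  move=> ilt; rewrite mem_filter /keep; apply/andP; split.
    by apply/orP; right; apply/hasP; exists i; rewrite ?mem_iota.
  apply: mem_pattern_atoms => [|x /[!inE]/eqP-> //].
  by apply/orP; right; apply: map_f; apply: (tDP _ (hD i)).1.
pose xs : n.-tuple 'I_pattern_vars := map_tuple (fun c => inord (index c s)) a.
have hxs c : c \in s -> h (inord (index c s) : 'I_pattern_vars) = c.
  by move=> cs; rewrite inordK ?idx // /h nth_index.
(* Were the pattern sound, its rule would belong to the program and, applied under [h], force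
   goal(a) into [D']. *)
have nsound : ~ sound_pattern xs body.
  move=> sb; have pp : proper_pattern xs body.
    apply/and3P; split; first exact/asboolP.
      (* There are at least two pattern variables, so the profile atom of variable 0 is always
         present. *)
      by apply: contraTneq (body_profile 0 isT) => ->.
    apply/allP => i _ /=; apply/vars_ofP; exists (profile_atom (tD (h i)) (val i)).
      exact: body_profile.
    exact: mem_head.
  have hb : all (fun F => atom_map h F \in D') body.
    apply/allP => F; rewrite mem_filter => /andP[/orP[/(fsubsetP DD')//|/hasP[i _ /eqP->]] _].
    by rewrite atom_map_profile; apply: (tDP _ (hD i)).2.
  have := rD' _ (pattern_rule_in pp) h hb; rewrite /= orbF; apply/negP.
  rewrite (_ : atom_map h _ = @Atom const (base, n) a) //.
  apply: atom_eq => //; rewrite /aargs /= -!map_comp -[RHS]map_id.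
  by apply/eq_in_map => c /as_/hxs.
have [A [h' [oA hb nu]]] : exists A h', [/\ ontology_structure A,
    all (fun F => atom_map h' F \in colored (sinst A)) body
    & ~ ucq_eval u (sinst A) (map_tuple (fun i : 'I_pattern_vars => h' i) xs)].
  apply: contrapT => H; apply: nsound => A h' oA hb.
  by apply: contrapT => nu; apply: H; exists A, h'.
exists A, (fun c => h' (index c s)); split=> //.
- move=> F FD Fs; rewrite -(atom_map_comp h' (index^~ s)).
  apply: colored_schema; last exact: (oD F FD).
  apply: (allP hb); rewrite mem_filter; apply/andP; split.
    rewrite /keep atom_map_comp atom_map_id_in ?FD // => c /Fs cs.
    by rewrite /h /= nth_index.
  apply: mem_pattern_atoms; first by rewrite (oD F FD).
  by move=> _ /mapP[c /Fs/idx ilt ->].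
- move=> c cs; have := allP hb _ (body_profile _ (idx c cs)).
  by rewrite atom_map_profile /h nth_index // => /colored_profile.
move=> H; apply: nu; move: H; congr (ucq_eval u (sinst A) _).
apply: val_inj; rewrite /= -map_comp; apply/eq_in_map => c /as_ /idx ilt /=.
by rewrite inordK.
Qed.

End ProgramOfOmq.

(** * Gluing realizing models to the data *)

Section Glue.
Variables (D : instance) (B : const -> structure) (r : const -> const).
Hypothesis r_dom : {in adom D, forall d, r d \in sdom (B d)}.

Definition fresh_const := (\max_(c <- enum_fset (adom D)) c).+1.

Lemma ltn_fresh_const d : d \in adom D -> d < fresh_const.
Proof. by move=> dD; rewrite ltnS (@leq_bigmax_seq _ _ xpredT id). Qed.

(* The copy of the root of B d is d itself; the other elements are moved away from
   the data. *)
Definition copy (d e : const) : const :=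
  if e == r d then d else (fresh_const + choice.pickle (d, e))%N.
(** A left inverse of copying for data constants d, arbitrary elsewhere: the anchor is the data
    constant whose copy contains the element, the local part its original in the model. *)
Definition uncopy (c : const) : const * const :=
  if c < fresh_const then (c, r c)
  else odflt (c, c) (choice.unpickle (c - fresh_const)).
Notation anchor c := (uncopy c).1.
Notation local c := (uncopy c).2.

Lemma copy_root d : copy d (r d) = d.
Proof. by rewrite /copy eqxx. Qed.

Lemma uncopyK d : d \in adom D -> uncopy d = (d, r d).
Proof. by move=> dD; rewrite /uncopy ltn_fresh_const. Qed.

Lemma copyK d e : d \in adom D -> uncopy (copy d e) = (d, e).
Proof.
move=> dD; rewrite /copy; case: eqP => [->|_]; first exact: uncopyK.
by rewrite /uncopy ltnNge leq_addr /= addKn choice.pickleK.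
Qed.

Definition glue_inst : instance := D `|`
  \bigcup_(d <- enum_fset (adom D)) [fset atom_map (copy d) F | F in sinst (B d)].
Definition glue_dom : {fset const} :=
  \bigcup_(d <- enum_fset (adom D)) [fset copy d e | e in sdom (B d)].

Lemma mem_glue_inst F : F \in glue_inst <-> F \in D \/
  exists d G, [/\ d \in adom D, G \in sinst (B d) & F = atom_map (copy d) G].
Proof.
rewrite in_fsetU; split=> [|[->//|[d [G [dD GB ->]]]]].
  case/orP => [|/bigfcupP[d /andP[dD _] /imfsetP[G GB ->]]]; first by left.
  by right; exists d, G.
apply/orP; right; apply/bigfcupP; exists d; first by rewrite dD.
by apply/imfsetP; exists G.
Qed.

Lemma mem_glue_dom c : c \in glue_dom <->
  exists d e, [/\ d \in adom D, e \in sdom (B d) & c = copy d e].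
Proof.
split=> [/bigfcupP[d /andP[dD _] /imfsetP[e eB ->]]|[d [e [dD eB ->]]]].
  by exists d, e.
apply/bigfcupP; exists d; first by rewrite dD.
by apply/imfsetP; exists e.
Qed.

(** Copies for different data constants are disjoint, so a fact from a copy has a single anchor for
    all its arguments. *)
Lemma glue_atom (V : eqType) (F : atom V) (pi : V -> const) : atom_map pi F \in glue_inst ->
  atom_map pi F \in D \/
  exists d, [/\ d \in adom D, {in aargs F, forall v, anchor (pi v) = d}
              & atom_map (fun v => local (pi v)) F \in sinst (B d)].
Proof.
case/mem_glue_inst => [|[d [G [dD GB E]]]]; first by left.
right; exists d; split=> // [v vF|].
  have: pi v \in aargs (atom_map pi F) by apply: map_f.
  by rewrite E => /mapP[e _ ->]; rewrite copyK.
rewrite -(atom_map_comp (fun c => local c)) E atom_map_comp atom_map_id_in // => e _ /=.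
by rewrite copyK.
Qed.

Lemma adom_glue c : c \in adom glue_inst ->
  anchor c \in adom D /\ (local c \in adom (sinst (B (anchor c))) \/ local c = r (anchor c)).
Proof.
case/adomP => F /mem_glue_inst[FD cF|[d [G [dD GB ->]]] /mapP[e eG ->]].
  have cD := mem_adom FD cF; rewrite uncopyK //; split=> //.
  by right.
by rewrite copyK //; split=> //; left; apply: mem_adom eG.
Qed.

Lemma glue_dom_adom : adom glue_inst `<=` glue_dom.
Proof.
apply/fsubsetP => c /adomP[F /mem_glue_inst[FD cF|[d [G [dD GB ->]]] /mapP[e eG ->]]];
  apply/mem_glue_dom.
  by have cD := mem_adom FD cF; exists c, (r c); rewrite copy_root r_dom.
by exists d, e; split=> //; apply: arg_sdom eG.
Qed.

Lemma glue_dom_neq0 : adom D != fset0 -> glue_dom != fset0.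
Proof.
case/fset0Pn => d dD; apply/fset0Pn; exists d; apply/mem_glue_dom.
by exists d, (r d); rewrite copy_root r_dom.
Qed.

(* What the data atoms between roots must respect for the subconcept C to keep its
   value in the glued structure. *)
Definition data_consistent (C : concept) : Prop :=
  match C with
  | CName N => forall c, @Atom const (N, 1) [tuple c] \in D -> csem (sinst (B c)) (CName N) (r c)
  | CEx R C' => forall c d, @Atom const (R, 2) [tuple c; d] \in D ->
      csem (sinst (B d)) C' (r d) -> csem (sinst (B c)) (CEx R C') (r c)
  | CAll R C' => forall c d, @Atom const (R, 2) [tuple c; d] \in D ->
      csem (sinst (B c)) (CAll R C') (r c) -> csem (sinst (B d)) C' (r d)
  | _ => True
  end.

(** A data fact can concern [copy d e] only when e is the root, the other copied elements being
    fresh for the data. *)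
Lemma glue_unary N d e : d \in adom D ->
  @Atom const (N, 1) [tuple copy d e] \in glue_inst ->
  (e = r d /\ @Atom const (N, 1) [tuple d] \in D) \/ @Atom const (N, 1) [tuple e] \in sinst (B d).
Proof.
move=> dD /mem_glue_inst[FD|[d' [G [d'D GB E]]]].
  left; have cd : copy d e \in adom D by apply: (mem_adom FD); apply: mem_head.
  by have := copyK e dD; rewrite uncopyK // => -[E <-]; rewrite E in FD *.
right; have := congr1 aargs E; rewrite -[aargs (atom_map _ _)]/(map (copy d') (aargs G)).
case Ea: (aargs G) => [|x [|]] //= [Ex].
have := congr1 uncopy Ex; rewrite !copyK // => -[Ed Ee]; rewrite Ed Ee.
by rewrite (_ : Atom _ = G) //; apply: atom_eq; [exact: (congr1 asymb E)|rewrite Ea].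
Qed.

Lemma glue_role R d e c : d \in adom D ->
  @Atom const (R, 2) [tuple copy d e; c] \in glue_inst ->
  [/\ e = r d, c \in adom D & @Atom const (R, 2) [tuple d; c] \in D] \/
  exists2 e', c = copy d e' & @Atom const (R, 2) [tuple e; e'] \in sinst (B d).
Proof.
move=> dD /mem_glue_inst[FD|[d' [G [d'D GB E]]]].
  left; have cd : copy d e \in adom D by apply: (mem_adom FD); apply: mem_head.
  have := copyK e dD; rewrite uncopyK // => -[E <-]; rewrite E in FD *; split=> //.
  by apply: (mem_adom FD); rewrite !inE eqxx orbT.
right; have := congr1 aargs E; rewrite -[aargs (atom_map _ _)]/(map (copy d') (aargs G)).
case Ea: (aargs G) => [|x [|y [|]]] //= [Ex Ey].
have := congr1 uncopy Ex; rewrite !copyK // => -[Ed Ee]; rewrite Ed Ee.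
exists y => //.
by rewrite (_ : Atom _ = G) //; apply: atom_eq; [exact: (congr1 asymb E)|rewrite Ea].
Qed.

(** Away from the root an element sees only facts of its own copy; at a root the additional data
    facts are what [data_consistent] controls. Proving an equivalence carries the induction through
    negation. *)
Lemma glue_csem C : (forall C', List.In C' (subconcepts C) -> data_consistent C') ->
  forall d e, d \in adom D -> csem glue_inst C (copy d e) <-> csem (sinst (B d)) C e.
Proof.
elim: C => [N||| C IH|C IHC C' IHC'|C IHC C' IHC'|R C IH|R C IH] H d e dD //=.
- split=> [/(glue_unary dD)[[-> FD]|//]|FB].
    exact: (H (CName N) (or_introl erefl)).
  apply/mem_glue_inst; right; exists d, (Atom (R := (N, 1)) [tuple e]).
  by split=> //; apply: atom_eq.
- by rewrite IH // => C' HC'; apply: H; right.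
- by rewrite IHC ?IHC' // => C1 HC1; apply: H; right; apply/List.in_app_iff; [right|left].
- by rewrite IHC ?IHC' // => C1 HC1; apply: H; right; apply/List.in_app_iff; [right|left].
- have {}IH := IH (fun C' HC' => H C' (or_intror HC')).
  split=> [[c /(glue_role dD)[[-> cD FD]|[e' -> FB]]]|[e' FB]].
  + rewrite -{1}(copy_root c) IH // => Cc.
    exact: (H (CEx R C) (or_introl erefl) _ _ FD).
  + by rewrite IH //; exists e'.
  rewrite -(IH _ _ dD); exists (copy d e') => //; apply/mem_glue_inst; right.
  by exists d, (Atom (R := (R, 2)) [tuple e; e']); split=> //; apply: atom_eq.
have {}IH := IH (fun C' HC' => H C' (or_intror HC')).
split=> [HC e' FB|HC c /(glue_role dD)[[E cD FD]|[e' -> FB]]].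
- rewrite -(IH _ _ dD); apply: HC; apply/mem_glue_inst; right.
  by exists d, (Atom (R := (R, 2)) [tuple e; e']); split=> //; apply: atom_eq.
- rewrite -(copy_root c) IH //; apply: (H (CAll R C) (or_introl erefl) _ _ FD).
  by rewrite -E.
by rewrite IH //; apply: HC.
Qed.

End Glue.

(** * The glued structure as a countermodel *)

Section GlueAnswers.
Variables (S : schema) (n : nat) (l : seq (concept * concept)) (u : ucq n).
Variables (D : instance) (a : n.-tuple const) (B : const -> structure) (r : const -> const).
Hypotheses (bS : binary S) (oD : over_schema S D) (aD : {subset a <= adom D}).
Hypothesis modelB :
  {in adom D, forall d, ontology_structure S l (B d) /\ r d \in adom (sinst (B d))}.
Hypothesis refutable : forall s,
    {subset a <= s} -> {subset s <= adom D} -> size s <= pattern_vars u ->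
  exists A (f : const -> const),
    [/\ ontology_structure S l A,
        forall F, F \in D -> {subset aargs F <= s} -> atom_map f F \in sinst A,
        {in s, forall c, f c \in adom (sinst A) /\
           profile l u (sinst A) (f c) = profile l u (sinst (B c)) (r c)}
      & ~ ucq_eval u (sinst A) (map_tuple f a)].

Let rB : {in adom D, forall d, r d \in sdom (B d)}.
Proof. by move=> d /modelB[_]; apply: (fsubsetP (sdom_adom (B d))). Qed.

Lemma relevant_sub CD C' : List.In CD l ->
  List.In C' (subconcepts CD.1) \/ List.In C' (subconcepts CD.2) ->
  List.In C' (relevant_concepts l).
Proof.
rewrite /relevant_concepts; elim: l => //= CD' s IHs [->|/IHs IH] H; apply/List.in_app_iff.
  by left; apply/List.in_app_iff.
by right; apply: IH.
Qed.

Lemma subconcepts_trans C1 C2 C3 : List.In C1 (subconcepts C2) -> List.In C2 (subconcepts C3) ->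
  List.In C1 (subconcepts C3).
Proof.
move=> H12; elim: C3 => [N||| C IH|C IHC C' IHC'|C IHC C' IHC'|R C IH|R C IH] [E|H];
  rewrite ?E //; right.
- exact: IH.
- by case/List.in_app_iff: H => [/IHC|/IHC'] H; apply/List.in_app_iff; [left|right].
- by case/List.in_app_iff: H => [/IHC|/IHC'] H; apply/List.in_app_iff; [left|right].
- exact: IH.
exact: IH.
Qed.

Lemma relevant_closed C C' : List.In C' (subconcepts C) -> List.In C (relevant_concepts l) ->
  List.In C' (relevant_concepts l).
Proof.
rewrite /relevant_concepts => H; elim: l => //= CD' s IHs; rewrite !List.in_app_iff => -[[]|/IHs].
- by move/(subconcepts_trans H); left; left.
- by move/(subconcepts_trans H); left; right.
by right.
Qed.

(** Each data fact maps into a single model where its arguments have the guessed profiles; there the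
    semantics of the concept gives the required implication, and equal profiles carry it back to the
    roots. *)
Lemma relevant_consistent C : List.In C (relevant_concepts l) -> data_consistent D B r C.
Proof.
have refutable2 c d : c \in adom D -> d \in adom D -> exists A (f : const -> const),
    [/\ forall F, F \in D -> {subset aargs F <= [:: c; d]} -> atom_map f F \in sinst A,
        profile l u (sinst A) (f c) = profile l u (sinst (B c)) (r c)
      & profile l u (sinst A) (f d) = profile l u (sinst (B d)) (r d)].
  (* [refutable] demands a list containing [a]; the two end points take the two spare pattern
     variables. *)
  move=> cD dD; have [|||A [f [_ Df pf _]]] := @refutable (a ++ [:: c; d]).
  - by move=> x xa; rewrite mem_cat xa.
  - by move=> x; rewrite mem_cat in_cons mem_seq1 => /or3P[/aD|/eqP->|/eqP->].
  - by rewrite size_cat size_tuple /= addn2 !ltnS leq_addr.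
  exists A, f; split.
  - by move=> F FD Fcd; apply: Df => // x /Fcd xcd; rewrite mem_cat xcd orbT.
  - by apply: (pf c _).2; rewrite mem_cat !inE eqxx orbT.
  - by apply: (pf d _).2; rewrite mem_cat !inE eqxx !orbT.
have role R c d : @Atom const (R, 2) [tuple c; d] \in D -> exists A c' d',
    [/\ @Atom const (R, 2) [tuple c'; d'] \in sinst A,
        profile l u (sinst A) c' = profile l u (sinst (B c)) (r c)
      & profile l u (sinst A) d' = profile l u (sinst (B d)) (r d)].
  move=> FD; have [|| A [f [Df pc pd]]] := @refutable2 c d.
  - by apply: (mem_adom FD); rewrite !inE eqxx.
  - by apply: (mem_adom FD); rewrite !inE eqxx orbT.
  exists A, (f c), (f d); split=> //.
  by rewrite (_ : Atom _ = atom_map f (Atom (R := (R, 2)) [tuple c; d])) ?Df //; apply: atom_eq.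
case: C => //= [N|R C|R C] HC.
- move=> c FD; have cD : c \in adom D by apply: (mem_adom FD); apply: mem_head.
  have [A [f [Df pc _]]] := refutable2 c c cD cD.
  suff: csem (sinst A) (CName N) (f c) by rewrite (profile_csem pc HC).
  rewrite /=.
  rewrite (_ : Atom _ = atom_map f (Atom (R := (N, 1)) [tuple c])); last exact: atom_eq.
  by apply: Df => // x; rewrite !inE => ->.
- move=> c d /role[A [c' [d' [FA pc pd]]]].
  have HC' : List.In C (relevant_concepts l) by apply: relevant_closed HC; right; case: (C); left.
  rewrite -(profile_csem pd HC') => Cd.
  suff: csem (sinst A) (CEx R C) c' by rewrite (profile_csem pc HC).
  by exists d'.
move=> c d /role[A [c' [d' [FA pc pd]]]].
have HC' : List.In C (relevant_concepts l) by apply: relevant_closed HC; right; case: (C); left.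
rewrite -(profile_csem pd HC') => H.
by apply: ((profile_csem pc HC).2 H).
Qed.

Hypothesis D_neq0 : adom D != fset0.

Definition glue : structure :=
  Structure (glue_dom_neq0 rB D_neq0) (glue_dom_adom rB).

Lemma glue_model : ontology_structure S l glue.
Proof.
split=> [F /mem_glue_inst[/oD FS|[d [G [dD GB ->]]]]|].
- by rewrite in_fsetU FS.
- by case: (modelB dD) => -[oB _] _; apply: oB GB.
apply/modelsP => CD CDl c /mem_glue_dom[d [e [dD eB ->]]].
have cons C : C = CD.1 \/ C = CD.2 ->
    forall C', List.In C' (subconcepts C) -> data_consistent D B r C'.
  move=> HC C' HC'; apply: relevant_consistent; apply: relevant_sub CDl _.
  by case: HC HC' => ->; [left|right].
have [[_ /modelsP/(_ CD CDl e eB) BCD] _] := modelB dD.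
by rewrite (glue_csem (cons _ (or_introl erefl))) // (glue_csem (cons _ (or_intror erefl))).
Qed.

(** A match in the glued structure is rebuilt in a refuting model [A] for the anchors of its
    variables: data atoms go through [f], and the literals in the copy of d form a rooted query that
    equal profiles transfer to [f d]. The pieces agree because each sends the variables at its root
    to the corresponding value of [f]. *)
Lemma glue_refutes : ~ ucq_eval u (sinst glue) a.
Proof.
move=> /List.Exists_exists[p [pu [_ [b bG]]]] pb.
pose pi := cq_assign a b.
pose anchor v := (uncopy D r (pi v)).1.
pose loc v := (uncopy D r (pi v)).2.
have piG v : pi v \in adom (glue_inst D B r).
  case: v => [i|j]; last exact/bG/mem_tnth.
  by apply: (adomS (fsubsetUl _ _)); apply/aD/mem_tnth.
have anchorD v : anchor v \in adom D by case: (adom_glue (piG v)).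
have [|||A [f [[oA mA] Df pf nu]]] :=
  @refutable (a ++ [seq anchor (inr j) | j <- enum 'I_(cq_nex p)]).
- by move=> c ca; rewrite mem_cat ca.
- by move=> c; rewrite mem_cat => /orP[/aD//|/mapP[j _ ->]].
- by rewrite size_cat size_map size_enum_ord size_tuple cq_nex_pattern.
set s := a ++ _ in Df pf.
have anchor_s v : anchor v \in s.
  case: v => [i|j]; rewrite mem_cat; last first.
    by apply/orP; right; apply/mapP; exists j; rewrite ?mem_enum.
  by rewrite /anchor uncopyK ?mem_tnth //; apply/aD/mem_tnth.
(* Variables anchored elsewhere are parked at the root of d; no literal of [in_copy d] mentions
   them. *)
pose gl d v := if anchor v == d then loc v else r d.
pose in_copy d (q : literal ('I_n + 'I_(cq_nex p))) :=
  all (fun v => anchor v == d) (literal_args q) && literal_holds (sinst (B d)) (gl d) q.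
pose roots d := [set v | gl d v == r d].
have /choice[g gP] : forall d, exists g : 'I_n + 'I_(cq_nex p) -> const, d \in s ->
    [/\ {in roots d, forall v, g v = f d},
        forall v, g v \in adom (sinst A)
      & forall q, List.In q (cq_body p) -> in_copy d q -> literal_holds (sinst A) g q].
  move=> d; case ds : (d \in s); last by exists (fun=> 0).
  have [fdA pd] := pf d ds.
  have [|g [g0 gA gb]] := (profile_rooted (in_copy d) (roots d) pd pu).2.
    exists (gl d); split=> [v|v|]; first by rewrite inE => /eqP.
      rewrite /gl; case: eqP => [<-|_]; last by right.
      by case: (adom_glue (piG v)).
    by rewrite -filter_mask all_filter; apply/all_In => q _; apply/implyP => /andP[].
  (* Since [f d] is in the active domain of [A], the exceptional root value of [rooted_query] is
     harmless. *)
  exists g => _; split=> // [v|]; first by case: (gA v) => // ->.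
  move: gb; rewrite -filter_mask all_filter => /all_In gb q qp.
  exact/implyP/gb.
(* Each variable takes its value from the partial match of its own anchor. *)
pose h v := g (anchor v) v.
have hroot v : pi v \in adom D -> h v = f (pi v).
  move=> vD; have E : anchor v = pi v by rewrite /anchor uncopyK.
  have [g0 _ _] := gP _ (anchor_s v); rewrite /h g0 -?E // inE /gl eqxx.
  by rewrite /loc uncopyK //= E.
apply: nu; apply/List.Exists_exists; exists p; split=> //.
have hA v : h v \in adom (sinst A) by case: (gP _ (anchor_s v)) => _ gA _; apply: gA.
split=> [c' /mapP[c /(nthP 0)[i + <-] ->]|].
  rewrite size_tuple => ilt.
  have iD : pi (inl (Ordinal ilt)) \in adom D by apply/aD/mem_tnth.
  by have := hA (inl (Ordinal ilt)); rewrite hroot // /pi /= (tnth_nth 0).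
exists [tuple h (inr j) | j < cq_nex p] => [c' /mapP[j _ ->]|]; first exact: hA.
apply/all_In => q qp.
rewrite (@eq_literal_holds _ _ _ h); last first.
  case=> [i|j] /=; last by rewrite tnth_mktuple.
  by rewrite tnth_map hroot //; apply/aD/mem_tnth.
have := (all_In _ _).1 pb q qp; case: q qp => [F|x y] qp /=; last first.
  move=> /eqP E; have Ea : anchor x = anchor y by rewrite /anchor /pi E.
  (* Variables with equal values share their anchor, so an equality literal lies within one copy. *)
  have [_ _ /(_ _ qp)] := gP _ (anchor_s x); rewrite /h -Ea; apply.
  by rewrite /in_copy /= /gl Ea !eqxx /= /loc /pi E eqxx.
move=> /glue_atom[FD|[d [dD Fd FB]]].
  rewrite (@eq_in_atom_map _ _ _ (f \o pi)) => [|v vF]; last first.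
    by apply: hroot; apply: (mem_adom FD); apply: map_f.
  rewrite -atom_map_comp; apply: Df => // _ /mapP[v vF ->].
  suff <- : anchor v = pi v by [].
  by rewrite /anchor uncopyK //; apply: (mem_adom FD); apply: map_f.
(* An argument of the atom is needed to see that its anchor d belongs to [s]. *)
have Fne : 0 < size (aargs F).
  have [[oB _] _] := modelB dD; have := oB _ FB; rewrite in_fsetU size_aargs.
  by case/orP => [/(binary_arity bS)|/sig_arity].
have [v0 v0F] : exists v, v \in aargs F.
  by case: (aargs F) Fne => // v t _; exists v; apply: mem_head.
have ds : d \in s by rewrite -(Fd v0 v0F); apply: anchor_s.
have [_ _ /(_ _ qp)] := gP d ds.
rewrite /= (@eq_in_atom_map _ _ _ h) => [|v vF]; last by rewrite /h /anchor Fd.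
apply; rewrite /in_copy /=; apply/andP; split.
  by apply/allP => v vF; apply/eqP/Fd.
rewrite (@eq_in_atom_map _ _ _ loc) // => v vF.
by rewrite /gl /anchor Fd // eqxx.
Qed.

End GlueAnswers.

(** If some [D'] omits goal(a), its guessed profiles are realized and every small set of data
    constants has a refuting model; gluing then yields a model of the ontology and the data in which
    the query fails at [a]. *)
Lemma certain_omq_program (S : schema) n (l : seq (concept * concept)) (u : ucq n)
    (D : instance) (a : n.-tuple const) :
    binary S -> over_schema S D -> (n = 0 -> D != fset0) ->
  certain_answers S (map inclusion l) (ucq_eval u) D a -> program_eval (omq_program S l u) D a.
Proof.
move=> bS oD n0 [aD H]; split=> // D' DD' _ rD'.
apply: contrapT => /negP aD'.
(* A constant comes from the answer tuple, or for Boolean queries from a fact of the non-empty data,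
   whose arity is positive. *)
have [d0 d0D] : exists d, d \in adom D.
  case: (posnP n) => [/n0/fset0Pn[F FD]|n_gt0]; last first.
    by exists (tnth a (Ordinal n_gt0)); apply/aD/mem_tnth.
  have := binary_arity bS (oD F FD); rewrite -size_aargs.
  case E: (aargs F) => [|c t] // _; exists c.
  by apply: (mem_adom FD); rewrite E mem_head.
have guess c : c \in adom D -> exists2 t, t \in profiles S l u & profile_atom S t c \in D'.
  move=> /adomP[F FD cF]; have FS := oD F FD.
  have /(nthP 0)[i] := cF; rewrite size_aargs => ilt Ec.
  (* Reading variable i as the i-th argument of [F] turns the generic body atom into [F] itself. *)
  have := rD' _ (guess_rule_in l u (Ordinal ilt) FS) (nth 0 (aargs F)); rewrite /= andbT.
  rewrite (_ : atom_map _ _ = F); last first.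
    apply: atom_eq => //; rewrite /aargs /= -map_comp -[RHS](mkseq_nth 0).
    by rewrite /mkseq size_aargs -val_enum_ord -map_comp.
  move=> /(_ (fsubsetP DD' _ FD))/hasP[_ /mapP[t tp ->]].
  by rewrite atom_map_profile /= Ec => tD; exists t.
have [t0 _ _] := guess _ d0D.
have /choice[tD tDP] : forall c, exists t, c \in adom D ->
    t \in profiles S l u /\ profile_atom S t c \in D'.
  move=> c; case cD: (c \in adom D); last by exists t0.
  by have [t tp tD] := guess c cD; exists t.
(* Constants outside the data receive a default structure, one realizing the profile of [d0]. *)
have /choice[Br BrP] : forall c, exists Br : structure * const, c \in adom D ->
    [/\ ontology_structure S l Br.1, Br.2 \in adom (sinst Br.1)
      & profile l u (sinst Br.1) Br.2 = tD c].
  have [/mem_profiles[A0 [c0 _]] _] := tDP _ d0D.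
  move=> c; case cD: (c \in adom D); last by exists (A0, c0).
  by have [/mem_profiles[A [e [oA eA Ee]]] _] := tDP c cD; exists (A, e).
pose B c := (Br c).1; pose r c := (Br c).2.
have modelB : {in adom D, forall d, ontology_structure S l (B d) /\ r d \in adom (sinst (B d))}.
  by move=> d /BrP[].
have refutable s : {subset a <= s} -> {subset s <= adom D} -> size s <= pattern_vars u ->
  exists A (f : const -> const),
    [/\ ontology_structure S l A,
        forall F, F \in D -> {subset aargs F <= s} -> atom_map f F \in sinst A,
        {in s, forall c, f c \in adom (sinst A) /\
           profile l u (sinst A) (f c) = profile l u (sinst (B c)) (r c)}
      & ~ ucq_eval u (sinst A) (map_tuple f a)].
  move=> as_ sD ss.
  have [A [f [oA Df pf nu]]] := refuting_structure oD DD' rD' aD' tDP d0D as_ sD ss.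
  exists A, f; split=> // c cs; have [fA ->] := pf c cs; split=> //.
  by have [_ _] := BrP c (sD c cs).
have D0 : adom D != fset0 by apply/fset0Pn; exists d0.
have := @glue_refutes S n l u D a B r bS aD modelB refutable D0; apply; apply: H.
- by case: (glue_model oD aD modelB refutable D0).
- by case: (glue_model oD aD modelB refutable D0).
exact: fsubsetUl.
Qed.

Theorem theorem1 :
  at_least_as_expressive equivalent_but_empty MDDlog (OMQ ALC UCQ) /\
  at_least_as_expressive equivalent (OMQ ALC UCQ) MDDlog.
Proof.
split=> S bS n q.
  case/OMQ_inv=> O [q' [/ALC_inclusions[l ->] /UCQ_inv[u ->] ->]].
  exists (program_eval (omq_program S l u)).
    by rewrite -{1}(omq_edb l u bS); constructor; apply: omq_mddlog.
  move=> D oD D0 a; split; first exact: certain_omq_program.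
  exact: omq_program_certain.
case/MDDlog_inv=> P mP [E ->]; rewrite {}E in bS *.
exists (certain_answers (edb P) (guess_ontology P) (ucq_eval (violation_ucq P))).
  constructor; last by constructor; apply: violation_ucq_symbs.
  by apply/List.Forall_map/List.Forall_forall => R _; constructor.
move=> D oD a; split; first exact: program_certain.
exact: certain_program.
Qed.
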